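(* Let $\mathfrak A$ be projective and spanning and let $z=\sum_{i=1}^n z_i\omega_i\in\mathfrak g_{\mathbb C}$ have all coordinates $z_i\ne0$. Under the embedding $$T\to\mathfrak g_{\mathbb C},\qquad w\mapsto (z_1e_{\beta_1}(w),\dots,z_ne_{\beta_n}(w)),$$ of the complex torus $T=\mathfrak t^*_{\mathbb C}/\Gamma_{\mathfrak t}^*$, the set of toric critical points $O_{\mathfrak B}(z)$ corresponds to the intersection of the orbit $\mathrm{Orb}_{\mathfrak B}(z)$ with the linear subspace $\mathfrak a_{\mathbb C}\subset\mathfrak g_{\mathbb C}$.
   Context: Setting. Let $0\to\mathfrak a\to\mathfrak g\xrightarrow{\pi}\mathfrak t\to0$ be an exact sequence of real vector spaces of dimensions $r,n,d$, where $\mathfrak g=\bigoplus_{i=1}^n\mathbb R\omega_i$ has lattice $\Gamma_{\mathfrak g}=\bigoplus\mathbb Z\omega_i$; assume $\Gamma_{\mathfrak a}=\Gamma_{\mathfrak g}\cap\mathfrak a$ has full rank in $\mathfrak a$ and put $\Gamma_{\mathfrak t}=\pi(\Gamma_{\mathfrak g})$. Let $\Gamma^*_{\mathfrak a},\Gamma_{\mathfrak t}^*$ be the dual lattices, $\mu:\mathfrak g^*\to\mathfrak a^*$ the dual map, $(\omega^i)$ the dual basis, $\alpha_i=\mu(\omega^i)$, $\beta_i=\pi(\omega_i)$, $\mathfrak A=[\alpha_1,\dots,\alpha_n]$ and $\mathfrak B=[\beta_1,\dots,\beta_n]$; the $\alpha_i$ generate $\Gamma_{\mathfrak a}^*$ over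 $\mathbb Z$. $\mathfrak A$ is projective if it lies in an open (linear) half space of $\mathfrak a^*$; it is spanning if for every $k$ the vector $\kappa=\sum_i\alpha_i$ can be written $\kappa=\sum_i t_i\alpha_i$ with $t_i\ge0$, $t_k=0$, $t_i\ne0$ for $i\neq k$. Subscript $\mathbb C$ denotes complexification; $\mathfrak g_{\mathbb C}\cong\mathbb C^n$ via the basis $\omega_i$. For $\beta\in\Gamma_{\mathfrak t}$ and $w\in T$, $e_\beta(w)=e^{2\pi\sqrt{-1}\langle w,\beta\rangle}$. $T$ acts on $\mathfrak g_{\mathbb C}$ diagonally with weights $\mathfrak B$, i.e. $w\cdot(x_1,\dots,x_n)=(e_{\beta_1}(w)x_1,\dots,e_{\beta_n}(w)x_n)$, and $\mathrm{Orb}_{\mathfrak B}(z)$ is the orbit of $z$. For a $\mathbb Z$-basis $(h_1,\dots,h_d)$ of $\Gamma^*_{\mathfrak t}$ let $f_k=-\sum_iz_i\langle h_k,\beta_i\rangle e_{\beta_i}$ be the toric partial derivatives of $f=1-\sum_iz_ie_{\beta_i}$; $O_{\mathfrak B}(z)=\{w\in T: f_1(w)=\dots=f_d(w)=0\}$. *)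

(* Defs.v *)
From HB Require Import structures.
From mathcomp Require Import all_boot all_order all_algebra.
From mathcomp Require Import generic_quotient ring_quotient complex.
From mathcomp Require Import all_classical all_reals all_analysis.

Set Implicit Arguments.
Unset Strict Implicit.
Unset Printing Implicit Defensive.
Import Order.TTheory GRing.Theory Num.Theory.

Local Open Scope classical_set_scope.
Local Open Scope ring_scope.
Local Open Scope complex_scope.
Local Open Scope quotient_scope.

(* The complexification of V: the pair (x, y) stands for x + sqrt(-1) y. *)
Definition complexification (R : rcfType) (V : lmodType R) : Type :=
  (V * V)%type.

HB.instance Definition _ (R : rcfType) (V : lmodType R) :=
  GRing.Zmodule.copy (complexification V) (V * V)%type.

Section Complexification.
Variables (R : rcfType) (V : lmodType R).
Implicit Types (c : R[i]) (x : complexification V).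

Definition complexification_scale c x : complexification V :=
  (complex.Re c *: x.1 - complex.Im c *: x.2,
   complex.Re c *: x.2 + complex.Im c *: x.1).

Fact complexification_scaleA c c' x :
  complexification_scale c (complexification_scale c' x) =
  complexification_scale (c * c') x.
Proof.
case: c c' x => [a b] [a' b'] [u v]; rewrite /complexification_scale /=.
congr pair.
  rewrite scalerBr scalerDr scalerBl scalerDl !scalerA !opprD !addrA.
  by rewrite -!addrA; congr (_ + _); rewrite addrA addrC.
rewrite scalerBr scalerDr scalerBl scalerDl !scalerA -!addrA; congr (_ + _).
by rewrite [RHS]addrC addrA.
Qed.

Fact complexification_scale1 : left_id 1 complexification_scale.
Proof.
case=> u v; rewrite /complexification_scale /=.
by rewrite !scale1r !scale0r subr0 addr0.
Qed.

Fact complexification_scaleDr :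
  right_distributive complexification_scale +%R.
Proof.
case=> [a b] [u v] [u' v']; rewrite /complexification_scale /=.
by congr pair; rewrite /= !scalerDr ?opprD addrACA.
Qed.

Fact complexification_scaleDl x :
  {morph complexification_scale^~ x : c c' / c + c'}.
Proof.
case: x => [u v] [a b] [a' b']; rewrite /complexification_scale /=.
by congr pair; rewrite /= !scalerDl ?opprD addrACA.
Qed.

HB.instance Definition _ :=
  GRing.Zmodule_isLmodule.Build R[i] (complexification V)
    complexification_scaleA complexification_scale1
    complexification_scaleDr complexification_scaleDl.

Definition to_complexification (v : V) : complexification V := (v, 0).

End Complexification.

Definition complexify_map (R : rcfType) (V W : vectType R) (f : 'Hom(V, W))
    (x : complexification V) : complexification W := (f x.1, f x.2).

Definition ccoord (R : rcfType) (V : vectType R) (n : nat) (b : n.-tuple V)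
    (i : 'I_n) (x : complexification V) : R[i] :=
  coord b i x.1 +i* coord b i x.2.

Definition dual (R : fieldType) (V : vectType R) : vectType R := 'Hom(V, R^o).

Definition dual_map (R : fieldType) (V W : vectType R) (f : 'Hom(V, W))
    (phi : dual W) : dual V := (phi \o f)%VF.

Definition dual_basis (R : fieldType) (V : vectType R) (n : nat)
    (b : n.-tuple V) (i : 'I_n) : dual V :=
  linfun (fun v => coord b i v : R^o).

(* The C-linear extension of the duality, V* _C x V -> C. *)
Definition cpairing (R : rcfType) (V : vectType R)
    (w : complexification (dual V)) (v : V) : R[i] := w.1 v +i* w.2 v.

Definition zspan (V : zmodType) (n : nat) (b : 'I_n -> V) : set V :=
  [set \sum_(i < n) b i *~ m i | m in [set: 'I_n -> int]].

Definition full_rank (R : fieldType) (V : vectType R) (L : set V) : Prop :=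
  exists s : seq V, (forall v, v \in s -> L v) /\ span s = fullv.

Definition zbasis (V : zmodType) (n : nat) (L : set V) (b : 'I_n -> V) : Prop :=
  L = zspan b /\
  forall m : 'I_n -> int,
    \sum_(i < n) b i *~ m i = 0 -> forall i, m i = 0.

Section Lattices.
Variables (R : realType) (V : vectType R).

Definition dual_lattice (L : set V) : set (dual V) :=
  [set phi : dual V | forall v, L v -> phi v \is a Num.int].

Definition period_lattice (L : set V) : {pred complexification (dual V)} :=
  mem ((@to_complexification R (dual V)) @` dual_lattice L).

Fact period_lattice_zmod_closed (L : set V) : zmod_closed (period_lattice L).
Proof.
split.
  by apply/mem_set; exists 0 => // v _; rewrite lfunE rpred0.
move=> x y /set_mem[phi Hphi <-] /set_mem[psi Hpsi <-]; apply/mem_set.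
exists (phi - psi); last by congr pair; rewrite /= subr0.
by move=> v Lv; rewrite add_lfunE opp_lfunE rpredB ?Hphi ?Hpsi.
Qed.

HB.instance Definition _ (L : set V) :=
  GRing.isZmodClosed.Build (complexification (dual V)) (period_lattice L)
    (period_lattice_zmod_closed L).

(* The complex torus V* _C / L*. *)
Definition torus (L : set V) : zmodType := Quotient.quot (period_lattice L).

End Lattices.

Definition cexp (R : realType) (c : R[i]) : R[i] :=
  (expR (complex.Re c))%:C * (cos (complex.Im c) +i* sin (complex.Im c)).

Section TorusCharacters.
Variables (R : realType) (V : vectType R) (L : set V).

(* e_b; it is independent of the chosen representative of w when L b holds
   (torus_exp_pi). *)
Definition torus_exp (b : V) (w : torus L) : R[i] :=
  cexp ((pi *+ 2)%:C * 'i * cpairing (repr w) b).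

Lemma cexpD2piz (c : R[i]) (m : R) :
  m \is a Num.int -> cexp (c + (pi *+ 2)%:C * 'i * m%:C) = cexp c.
Proof.
case/intrP => k ->; case: c => x y; rewrite /cexp /=.
rewrite !(mulr0, mul0r, mulr1, subr0, addr0, add0r).
have E (n : nat) (u : R) : cos (u + pi *+ 2 *+ n) = cos u /\
    sin (u + pi *+ 2 *+ n) = sin u.
  by rewrite (periodicn (@cosD2pi R)) (periodicn (@sinD2pi R)).
suff [-> ->] : cos (y + pi *+ 2 * k%:~R) = cos y /\
    sin (y + pi *+ 2 * k%:~R) = sin y.
  by rewrite oppr0 mul0r addr0.
rewrite mulrzr; case: k => n; first exact: E.
have := E n.+1 (y - pi *+ 2 *+ n.+1).
by rewrite subrK NegzE mulrNz => -[-> ->].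
Qed.

Lemma torus_exp_pi (b : V) (w : complexification (dual V)) :
  L b -> torus_exp b (\pi_(torus L) w) =
         cexp ((pi *+ 2)%:C * 'i * cpairing w b).
Proof.
move=> Lb; rewrite /torus_exp; set w' := repr _.
have : w' - w \in period_lattice L.
  by rewrite Quotient.idealrBE /w' reprK.
case/set_mem => phi Hphi E.
have -> : w' = w + to_complexification phi by rewrite E addrC subrK.
have -> : cpairing (w + to_complexification phi) b =
    cpairing w b + (phi b)%:C.
  by apply/eqP; rewrite eq_complex /= !add_lfunE lfunE /= addr0 !eqxx.
by rewrite mulrDr cexpD2piz // Hphi.
Qed.

End TorusCharacters.

(* When V is a dual space a^*, half spaces are cut out by elements of a^**. *)
Definition projective (R : realFieldType) (V : vectType R) (n : nat)
    (A : 'I_n -> V) : Prop :=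
  exists l : dual V, l != 0 /\ forall i, 0 < l (A i).

Definition spanning (R : realFieldType) (V : vectType R) (n : nat)
    (A : 'I_n -> V) : Prop :=
  forall k : 'I_n, exists s : 'I_n -> R,
    [/\ forall i, 0 <= s i, s k = 0, forall i, i != k -> s i != 0 &
        \sum_(i < n) A i = \sum_(i < n) s i *: A i].

Section ToricData.
Variables (R : realType) (n d : nat) (a g t : vectType R).
Variables (iota : 'Hom(a, g)) (p : 'Hom(g, t)) (omega : n.-tuple g).

Definition lattice_g : set g := zspan (tnth omega).
Definition lattice_a : set a := iota @^-1` lattice_g.
Definition lattice_t : set t := p @` lattice_g.

Definition config_A (i : 'I_n) : dual a := dual_map iota (dual_basis omega i).
Definition config_B (i : 'I_n) : t := p (tnth omega i).

Definition subspace_aC : set (complexification g) :=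
  range (complexify_map iota).

Definition torus_act (w : torus lattice_t) (x : complexification g) :
    complexification g :=
  \sum_(i < n) (torus_exp (config_B i) w * ccoord omega i x)
                 *: to_complexification (tnth omega i).

Definition torus_orbit (z : complexification g) : set (complexification g) :=
  range (torus_act^~ z).

Definition torus_embedding (z : complexification g) (w : torus lattice_t) :
    complexification g :=
  \sum_(i < n) (ccoord omega i z * torus_exp (config_B i) w)
                 *: to_complexification (tnth omega i).

Definition toric_partial (z : complexification g) (hk : dual t)
    (w : torus lattice_t) : R[i] :=
  - \sum_(i < n) ccoord omega i z * (hk (config_B i))%:C
                   * torus_exp (config_B i) w.

Definition toric_critical (h : 'I_d -> dual t) (z : complexification g) :
    set (torus lattice_t) :=
  [set w | forall k, toric_partial z (h k) w = 0].

End ToricData.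

Arguments torus_act {R n g t} p omega w x.
Arguments torus_orbit {R n g t} p omega z.
Arguments torus_embedding {R n g t} p omega z w.
Arguments toric_partial {R n g t} p omega z hk w.
Arguments toric_critical {R n d g t} p omega h z.

(* Main.v *)
Require Import Defs.
From mathcomp Require Import all_boot all_order all_algebra.
From mathcomp Require Import generic_quotient ring_quotient complex.
From mathcomp Require Import all_classical all_reals all_analysis.
From mathcomp Require Import ring lra.

Set Implicit Arguments.
Unset Strict Implicit.
Unset Printing Implicit Defensive.
Import Order.TTheory GRing.Theory Num.Theory.

Local Open Scope classical_set_scope.
Local Open Scope ring_scope.
Local Open Scope complex_scope.

(** The point X = (z_i e_(beta_i)(w)) that w is sent to is also w acting on z,
so the image of the embedding is the orbit of z.  It remains to see which w land
in a_C, and that w is determined by its image.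

Pairing h_k with p X gives sum_i z_i <h_k, beta_i> e_(beta_i)(w), which is
minus the k-th toric partial derivative at w ([toric_partialE]).  By exactness
X lies in a_C iff p X = 0, which gives f_k(w) = 0 for all k.  For the converse
the h_k must separate the points of t.  This is where the full rank of the
lattice of a enters ([dual_lattice_separates]): a is then cut out in g by
linear equations with rational, hence with integer, coefficients, and each such
equation is an element of the dual lattice of the lattice of t, i.e. an integer
combination of the h_k.

For injectivity, since every z_i is nonzero, the image of w determines all
e_(beta_i)(w).  Two lifts with the same characters differ by a functional whose
values on the beta_i are real integers ([cexp_2pii_eq]); as the beta_i span t
and generate its lattice, it is a real functional in the dual lattice
([torus_char_inj]). *)

Lemma cos_eq1_period (R : realType) (x : R) :
  0 <= x < pi *+ 2 -> cos x = 1 -> x = 0.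
Proof.
move=> /andP[x_ge0 x_lt] cosx; apply/eqP/negP => /negP x_neq0.
have /lt0r_neq0/eqP[] : 0 < sin (x / 2).
  have x_gt0 : 0 < x by rewrite lt0r x_neq0.
  by apply: sin_gt0_pi; rewrite divr_gt0 //= ltr_pdivrMr // mulr_natr.
have := cos_mulr2n (x / 2).
rewrite -[X in cos X]mulr_natr divfK ?pnatr_eq0 // cosx => dbl.
have pyth := cos2Dsin2 (x / 2).
have : sin (x / 2) ^+ 2 = 0 by lra.
by move/eqP; rewrite sqrf_eq0 => /eqP.
Qed.

Lemma cexp_inj_strip (R : realType) (x y x' y' : R) :
  0 <= y - y' < pi *+ 2 ->
  cexp (x +i* y) = cexp (x' +i* y') -> x +i* y = x' +i* y'.
Proof.
rewrite /cexp => yy' /eqP; rewrite eq_complex /= !mul0r subr0 addr0 subr0 addr0.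
move=> /andP[/eqP Ec /eqP Es].
(* Squared moduli give x = x'; only then do the cosines and sines agree. *)
have norm (u v : R) :
    (expR u * cos v) ^+ 2 + (expR u * sin v) ^+ 2 = expR u ^+ 2.
  by rewrite !exprMn -mulrDr cos2Dsin2 mulr1.
have xx' : x = x'.
  apply/expR_inj/eqP; rewrite -(@eqrXn2 _ 2) ?expR_ge0 //.
  by rewrite -(norm x y) -(norm x' y') Ec Es.
move: Ec Es; rewrite xx' => /(mulfI (lt0r_neq0 (expR_gt0 _))) Ec.
move=> /(mulfI (lt0r_neq0 (expR_gt0 _))) Es.
suff /eqP : y - y' = 0 by rewrite subr_eq0 => /eqP ->.
by apply: cos_eq1_period => //; rewrite cosB Ec Es -!expr2 cos2Dsin2.
Qed.

(** The kernel of c |-> exp(2 pi i c) is exactly the real integers; the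
candidate integer is the floor of Re (c - c'). *)
Lemma cexp_2pii_eq (R : realType) (c c' : R[i]) :
  cexp ((pi *+ 2)%:C * 'i * c) = cexp ((pi *+ 2)%:C * 'i * c') ->
  exists2 m : R, m \is a Num.int & c - c' = m%:C.
Proof.
move=> E; set m := (Num.floor (complex.Re (c - c')))%:~R : R.
have m_int : m \is a Num.int by rewrite intr_int.
exists m => //; apply/eqP; rewrite subr_eq addrC -subr_eq; apply/eqP.
have twopi_gt0 : 0 < pi *+ 2 :> R by rewrite pmulrn_rgt0 ?pi_gt0.
(* Shifting c by m changes nothing and brings Re (c - c') into [0, 1). *)
have E' : cexp ((pi *+ 2)%:C * 'i * (c - m%:C)) =
    cexp ((pi *+ 2)%:C * 'i * c').
  by rewrite -E -[in RHS](subrK m%:C c) [in RHS]mulrDr cexpD2piz.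
have tE (u : R[i]) : (pi *+ 2)%:C * 'i * u =
    (- (pi *+ 2 * complex.Im u)) +i* (pi *+ 2 * complex.Re u).
  case: u => u v; apply/eqP; rewrite eq_complex /=.
  by apply/andP; split; apply/eqP; ring.
have range : 0 <= pi *+ 2 * complex.Re (c - m%:C) - pi *+ 2 * complex.Re c'
    < pi *+ 2.
  rewrite -mulrBr.
  have -> : complex.Re (c - m%:C) - complex.Re c' = complex.Re (c - c') - m.
    by case: (c) (c') => [? ?] [? ?] /=; rewrite addrAC.
  have /andP[lo hi] := floor_itv (complex.Re (c - c')).
  rewrite mulr_ge0 ?subr_ge0 ?(ltW twopi_gt0) //=.
  by rewrite gtr_pMr // ltrBlDl -intrD1.
move: E'; rewrite !tE => /(cexp_inj_strip range)[].
move=> /oppr_inj/(mulfI (lt0r_neq0 twopi_gt0)) Im.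
move=> /(mulfI (lt0r_neq0 twopi_gt0)) Re.
by apply/eqP; rewrite eq_complex Im Re !eqxx.
Qed.

Lemma common_denominator (R : archiRealFieldType) (I : finType) (q : I -> rat) :
  exists2 D : R, D != 0 & forall i, D * ratr (q i) \is a Num.int.
Proof.
exists (\prod_i (denq (q i))%:~R).
  by apply/prodf_neq0 => i _; rewrite intr_eq0 denq_neq0.
move=> i; rewrite (bigD1 i) //= mulrAC rpredM //; last first.
  by rewrite rpred_prod // => j _; exact: intr_int.
by rewrite mulrC -ratr_int -rmorphM /= -numqE ratr_int intr_int.
Qed.

Lemma coord_lattice_g (R : realType) (n : nat) (g : vectType R)
    (omega : n.-tuple g) (i : 'I_n) (x : g) :
  basis_of fullv omega -> lattice_g omega x -> coord omega i x \is a Num.int.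
Proof.
move=> /basis_free fr [m _ <-].
under eq_bigr do rewrite -scaler_int (tnth_nth 0).
by rewrite coord_sum_free // intr_int.
Qed.

(** Write v = p u.  The rows of B are the integer coordinates of lattice vectors
spanning a, so that u lies in a iff its coordinate row is annihilated by the
cokernel of B.  Gaussian elimination commutes with field extension, so this
cokernel can be computed over the rationals.  Its columns are functionals on g
that kill a, hence come from t, and after clearing denominators they come from
the dual lattice. *)
Lemma dual_lattice_separates (R : realType) (n : nat) (a g t : vectType R)
    (iota : 'Hom(a, g)) (p : 'Hom(g, t)) (omega : n.-tuple g) (v : t) :
  limg iota = lker p -> limg p = fullv -> basis_of fullv omega ->
  full_rank (lattice_a iota omega) ->
  (forall phi, dual_lattice (lattice_t p omega) phi -> phi v = 0) -> v = 0.
Proof.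
move=> exseq surj bas [s [sL sspan]] vanish.
pose b (j : 'I_(size s)) i := coord omega i (iota s`_j).
pose B : 'M[rat]_(size s, n) := \matrix_(j, i) (Num.floor (b j i))%:~R.
have BE : map_mx ratr B = \matrix_(j, i) b j i :> 'M[R]_(size s, n).
  apply/matrixP => j i; rewrite !mxE ratr_int; apply/floorK.
  by apply: coord_lattice_g => //; apply/sL/mem_nth.
pose C := cokermx B.
pose psi k : dual g := \sum_i ratr (C i k) *: dual_basis omega i.
have psiE k x : psi k x = \sum_i coord omega i x * ratr (C i k).
  rewrite sum_lfunE; apply: eq_bigr => i _.
  by rewrite scale_lfunE lfunE mulrC.
have psi_iota k x : psi k (iota x) = 0.
  have : x \in span s by rewrite sspan memvf.
  rewrite -(in_tupleE s) => /coord_span ->.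
  rewrite !linear_sum big1 //= => j _.
  rewrite !linearZ /= psiE.
  suff -> : \sum_i coord omega i (iota s`_j) * ratr (C i k) = 0.
    by rewrite scaler0.
  have := mulmx_coker (map_mx ratr B : 'M[R]_(_, _)).
  rewrite -map_cokermx BE => /matrixP/(_ j k); rewrite !mxE => E.
  rewrite -[RHS]E; by apply: eq_bigr => i _; rewrite !mxE.
have /memv_imgP[u _ vE] : v \in limg p by rewrite surj memvf.
(* (p^-1)%VF is a linear section of p; a functional that vanishes on lker p
   does not see which section is taken, and so descends to t. *)
have psi_inv k x : psi k (p^-1%VF (p x)) = psi k x.
  apply/eqP; rewrite -subr_eq0 -linearB; apply/eqP.
  have : p^-1%VF (p x) - x \in limg iota.
    by rewrite exseq memv_ker linearB /= limg_lfunVK ?memv_img ?memvf// subrr.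
  by case/memv_imgP => y _ ->; exact: psi_iota.
have psiu k : psi k u = 0.
  have [D D0 Dint] := @common_denominator R _ (fun i => C i k).
  pose phi : dual t := D *: (psi k \o p^-1)%VF.
  have phiE x : phi (p x) = D * psi k x.
    by rewrite /phi scale_lfunE comp_lfunE psi_inv.
  have /vanish : dual_lattice (lattice_t p omega) phi.
    move=> _ [x xL <-]; rewrite phiE psiE mulr_sumr rpred_sum // => i _.
    by rewrite mulrCA rpredM // coord_lattice_g.
  by rewrite vE phiE => /eqP; rewrite mulf_eq0 (negPf D0) => /eqP.
pose U := \row_i coord omega i u.
have : (U <= map_mx ratr B)%MS.
  rewrite submxE -map_cokermx; apply/eqP/matrixP => i k.
  rewrite !mxE -[RHS](psiu k) psiE; apply: eq_bigr => l _.
  by rewrite !mxE.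
case/submxP => w /rowP UE; rewrite vE; apply/eqP.
rewrite -memv_ker -exseq.
suff -> : u = iota (\sum_j w 0 j *: s`_j) by rewrite memv_img ?memvf.
have full x : x \in <<omega>>%VS by rewrite (span_basis bas) memvf.
rewrite (coord_span (full u)) [RHS](coord_span (full _)).
apply: eq_bigr => i _; congr (_ *: _).
have := UE i; rewrite !mxE => ->; rewrite !linear_sum; apply: eq_bigr => j _.
by rewrite !linearZ BE !mxE.
Qed.

Lemma sum_complexification (R : rcfType) (g : vectType R) (n : nat)
    (omega : n.-tuple g) (c : 'I_n -> R[i]) :
  \sum_i c i *: to_complexification (tnth omega i) =
  (\sum_i complex.Re (c i) *: tnth omega i,
   \sum_i complex.Im (c i) *: tnth omega i) :> complexification g.
Proof.
elim/big_rec3: _ => // i x y _ _ ->.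
rewrite -[c i *: _]/(complexification_scale _ _) /complexification_scale /=.
by rewrite !scaler0 subr0 add0r.
Qed.

(** The characters e_(beta_i) separate the points of the torus: the real part of
the difference of two lifts is integral on the lattice of t, and its imaginary
part vanishes on the beta_i, which span t. *)
Lemma torus_char_inj (R : realType) (n : nat) (g t : vectType R)
    (p : 'Hom(g, t)) (omega : n.-tuple g) (w w' : torus (lattice_t p omega)) :
  limg p = fullv -> basis_of fullv omega ->
  (forall i, torus_exp (config_B p omega i) w =
             torus_exp (config_B p omega i) w') ->
  w = w'.
Proof.
move=> surj bas eqw.
have diff i : exists2 m : R, m \is a Num.int &
    (repr w - repr w').1 (config_B p omega i) = m /\
    (repr w - repr w').2 (config_B p omega i) = 0.
  have [m mint /eqP] := cexp_2pii_eq (eqw i).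
  rewrite eq_complex /= => /andP[/eqP E1 /eqP E2]; exists m => //.
  by split; rewrite /= add_lfunE opp_lfunE; [exact: E1 | exact: E2].
have im0 : (repr w - repr w').2 = 0.
  apply/lfunP => v; rewrite [RHS]lfunE /=.
  have /memv_imgP[u _ ->] : v \in limg p by rewrite surj memvf.
  have /coord_span -> : u \in <<omega>>%VS by rewrite (span_basis bas) memvf.
  rewrite !linear_sum big1 // => i _; rewrite !linearZ /= -tnth_nth.
  by have [? _ [_ ->]] := diff i; rewrite scaler0.
rewrite -[w]reprK -[w']reprK; apply/eqP.
rewrite -Quotient.idealrBE; apply/mem_set.
exists (repr w - repr w').1.
  move=> _ [_ [m _ <-] <-]; rewrite !linear_sum rpred_sum // => i _.
  by rewrite !raddfMz rpredMz //=; have [? ? [-> _]] := diff i.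
by rewrite /to_complexification -im0 -surjective_pairing.
Qed.

Lemma sum_complexZ (R : rcfType) (n : nat)
    (c : 'I_n -> R[i]) (x : 'I_n -> R) :
  \sum_i c i * (x i)%:C =
  (\sum_i complex.Re (c i) * x i) +i* (\sum_i complex.Im (c i) * x i).
Proof.
elim/big_rec3: _ => // i u v _ _ ->; case: (c i) => a b.
by apply/eqP; rewrite eq_complex /= !mulr0 subr0 add0r !eqxx.
Qed.

Lemma subspace_aCP (R : realType) (a g t : vectType R)
    (iota : 'Hom(a, g)) (p : 'Hom(g, t)) (x : complexification g) :
  limg iota = lker p ->
  subspace_aC iota x <-> p x.1 = 0 /\ p x.2 = 0.
Proof.
move=> exseq; split=> [[y _ <-] /= | [p1 p2]].
  by split; apply/eqP; rewrite -memv_ker -exseq memv_img ?memvf.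
have lift v : p v = 0 -> exists u, v = iota u.
  move/eqP; rewrite -memv_ker -exseq => /memv_imgP[u _ ->].
  by exists u.
have [u1 E1] := lift _ p1; have [u2 E2] := lift _ p2.
exists (u1, u2) => //.
by rewrite /complexify_map /= -E1 -E2 -surjective_pairing.
Qed.

(** The toric partial derivative depends on w only through the image point, and
linearly: up to sign it pairs the functional with the projection to t_C. *)
Lemma toric_partialE (R : realType) (n : nat) (g t : vectType R)
    (p : 'Hom(g, t)) (omega : n.-tuple g) (z : complexification g)
    (phi : dual t) (w : torus (lattice_t p omega)) :
  toric_partial p omega z phi w =
    - (phi (p (torus_embedding p omega z w).1) +i*
       phi (p (torus_embedding p omega z w).2)).
Proof.
pose c i := ccoord omega i z * torus_exp (config_B p omega i) w.
pose x i : R := phi (config_B p omega i).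
transitivity (- \sum_i c i * (x i)%:C).
  by congr (- _); apply: eq_bigr => i _; rewrite mulrAC.
rewrite [torus_embedding _ _ _ _](sum_complexification omega c) sum_complexZ.
(* From here on only linearity in the coefficients c matters. *)
clearbody c; rewrite !linear_sum; congr (- (_ +i* _)).
  by apply: eq_bigr => i _; rewrite !linearZ.
by apply: eq_bigr => i _; rewrite !linearZ.
Qed.

Theorem proposition4p2 (R : realType) (r n d : nat) (a g t : vectType R)
    (iota : 'Hom(a, g)) (p : 'Hom(g, t)) (omega : n.-tuple g)
    (h : 'I_d -> dual t) (z : complexification g) :
  \dim {:a} = r -> \dim {:g} = n -> \dim {:t} = d ->
  lker iota = 0%VS -> limg iota = lker p -> limg p = fullv ->
  basis_of fullv omega ->
  full_rank (lattice_a iota omega) ->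
  zbasis (dual_lattice (lattice_t p omega)) h ->
  projective (config_A iota omega) ->
  spanning (config_A iota omega) ->
  (forall i : 'I_n, ccoord omega i z != 0) ->
  injective (torus_embedding p omega z) /\
  torus_embedding p omega z @` toric_critical p omega h z =
    torus_orbit p omega z `&` subspace_aC iota.
Proof.
move=> _ _ _ _ exseq surj bas rank [hspan _] _ _ z_neq0.
split=> [w w' | ].
  rewrite /torus_embedding !sum_complexification => -[Ere Eim].
  apply: torus_char_inj => // i; apply: (mulfI (z_neq0 i)).
  have coordE (c c' : 'I_n -> R) : \sum_i c i *: tnth omega i =
      \sum_i c' i *: tnth omega i -> c i = c' i.
    move/(congr1 (coord omega i)).
    under eq_bigr do rewrite (tnth_nth 0).
    under [in RHS]eq_bigr do rewrite (tnth_nth 0).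
    by rewrite !coord_sum_free // (basis_free bas).
  apply/eqP; rewrite eq_complex; apply/andP; split; apply/eqP.
    exact: (coordE (fun i => complex.Re _) (fun i => complex.Re _)).
  exact: (coordE (fun i => complex.Im _) (fun i => complex.Im _)).
have embedding_act w : torus_embedding p omega z w = torus_act p omega w z.
  by apply: eq_bigr => i _; rewrite mulrC.
have h_separates v : (forall k, h k v = 0) -> v = 0.
  move=> hv; apply: (dual_lattice_separates exseq surj bas rank).
  rewrite hspan => _ [m _ <-]; rewrite sum_lfunE big1 // => k _.
  by rewrite -scaler_int scale_lfunE hv scaler0.
have crit w : toric_critical p omega h z w <->
    subspace_aC iota (torus_embedding p omega z w).
  rewrite (subspace_aCP _ exseq); split=> [hw | [p1 p2] k].
    by split; apply: h_separates => k; have := hw k;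
      rewrite toric_partialE => /eqP; rewrite oppr_eq0 eq_complex /=
      => /andP[/eqP ? /eqP].
  apply/eqP; rewrite toric_partialE p1 p2 oppr_eq0 eq_complex /= !linear0.
  by rewrite eqxx.
apply/seteqP; split=> [_ [w /crit aw <-] | _ [[w _ <-] aw]].
  by split=> //; exists w => //; rewrite -embedding_act.
by exists w; [apply/crit|]; rewrite embedding_act.
Qed.
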